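(* Let $f:A\to B$ be a morphism of commutative rings which lifts idempotents, and suppose that $B$ has only finitely many maximal ideals. Then the induced ring map $K_0(f):K_0(A)\to K_0(B)$ is surjective.
   Context: A morphism of rings $f:A\to B$ lifts idempotents if for every idempotent $e'\in B$ there exists an idempotent $e\in A$ with $f(e)=e'$. $K_0(A)$ is the Grothendieck ring of the semiring of isomorphism classes of finitely generated projective $A$-modules (addition $\oplus$, multiplication $\otimes_A$); its elements are written $[M,N]$ (the formal difference of the class of $M$ and the class of $N$). The ring map $K_0(f)$ is given by $[M,N]\mapsto[M\otimes_A B, N\otimes_A B]$. *)

(* Defs.v *)
From HB Require Import structures.
From mathcomp Require Import all_boot all_order all_algebra.
From mathcomp Require Import ring.
From mathcomp Require Import boolp classical_sets cardinality.

Set Implicit Arguments.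
Unset Strict Implicit.
Unset Printing Implicit Defensive.

Import GRing.Theory.
Local Open Scope ring_scope.
Local Open Scope quotient_scope.

(* Rings are [comPzRingType]s: commutative with unit, possibly zero.          *)

Section Ideals.
Variable B : comPzRingType.

Definition is_ideal (I : set B) : Prop :=
  [/\ I 0, forall x y, I x -> I y -> I (x + y) & forall a x, I x -> I (a * x)].

Definition is_maximal_ideal (I : set B) : Prop :=
  [/\ is_ideal I, I <> [set: B]%classic
    & forall J : set B, is_ideal J -> (I `<=` J)%classic ->
        J = I \/ J = [set: B]%classic].

End Ideals.

Definition lifts_idempotents (A B : comPzRingType) (f : {rmorphism A -> B}) :=
  forall e' : B, e' * e' = e' -> exists2 e : A, e * e = e & f e = e'.

Section Modules.
Variable A : comPzRingType.
Implicit Types M N P : lmodType A.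

Definition surj (T U : Type) (g : T -> U) := forall y, exists x, g x = y.

Definition fin_gen M : Prop :=
  exists n (x : 'I_n -> M), forall m, exists a : 'I_n -> A,
    m = \sum_i a i *: x i.

Definition projective M : Prop :=
  forall (N P : lmodType A) (g : {linear N -> P}) (h : {linear M -> P}),
    surj g -> exists k : {linear M -> N}, forall m, g (k m) = h m.

Definition iso M N : Prop := exists g : {linear M -> N}, bijective g.

Record fgproj := FgProj {
  fgproj_mod :> lmodType A;
  fgproj_fin_gen : fin_gen fgproj_mod;
  fgproj_projective : projective fgproj_mod }.

Definition mk_linear M N (g : M -> N) (gL : linear g) : {linear M -> N} :=
  HB.pack g (GRing.isLinear.Build A M N *:%R g gL).

Lemma mk_iso M N (g : M -> N) (h : N -> M) :
  linear g -> cancel g h -> cancel h g -> iso M N.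
Proof. by move=> gL gK hK; exists (mk_linear gL); exists h. Qed.

Lemma iso_refl M : iso M M.
Proof. by apply: (@mk_iso M M id id). Qed.

Lemma iso_ex M N : iso M N -> exists (g : {linear M -> N}) (h : {linear N -> M}),
  cancel g h /\ cancel h g.
Proof.
case=> g [h gK hK]; have hL : linear h.
  by move=> a u v; rewrite -{1}[u]hK -{1}[v]hK -linearP gK.
by exists g, (mk_linear hL).
Qed.

Lemma iso_sym M N : iso M N -> iso N M.
Proof. by case/iso_ex=> g [h [gK hK]]; exists h; exists g. Qed.

Lemma iso_trans N M P : iso M N -> iso N P -> iso M P.
Proof.
case/iso_ex=> g [h [gK hK]] /iso_ex[g' [h' [gK' hK']]].
apply: (@mk_iso M P (g' \o g) (h \o h')) => [a u v|x|x] /=.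
- by rewrite !linearP.
- by rewrite gK' gK.
- by rewrite hK hK'.
Qed.

Definition dual_basis M : Prop :=
  exists n (x : 'I_n -> M) (c : 'I_n -> {linear M -> A^o}),
    forall m, m = \sum_i (c i m : A) *: x i.

Lemma dual_basis_fin_gen M : dual_basis M -> fin_gen M.
Proof. by case=> n [x [c cE]]; exists n, x => m; exists (fun i => c i m). Qed.

Lemma dual_basis_projective M : dual_basis M -> projective M.
Proof.
case=> n [x [c cE]] N P g h gS.
have /choice[y yE] : forall i, exists y, g y = h (x i) by move=> i; apply: gS.
have kL : linear (fun m => \sum_i (c i m : A) *: y i).
  move=> a u v; rewrite scaler_sumr -big_split; apply: eq_bigr => i _ /=.
  by rewrite linearP scalerDl scalerA.
exists (mk_linear kL) => m /=; rewrite linear_sum {2}[m]cE linear_sum.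
by apply: eq_bigr => i _; rewrite !linearZ yE.
Qed.

Lemma comb_linear M n (x : 'I_n -> M) :
  linear (fun v : 'rV[A]_n => \sum_i v 0 i *: x i).
Proof.
move=> a u v; rewrite scaler_sumr -big_split; apply: eq_bigr => i _ /=.
by rewrite !mxE scalerDl scalerA.
Qed.

Lemma fin_gen_surj M : fin_gen M ->
  exists n (p : {linear 'rV[A]_n -> M}), surj p.
Proof.
case=> n [x xP]; exists n, (mk_linear (comb_linear x)) => m.
have [a ->] := xP m; exists (\row_i a i) => /=.
by apply: eq_bigr => i _; rewrite mxE.
Qed.

Lemma fgproj_dual_basis (M : fgproj) : dual_basis M.
Proof.
have [n [p pS]] := fin_gen_surj (fgproj_fin_gen M).
have idL : linear (id : M -> M) by [].
have [k kE] := fgproj_projective (mk_linear idL) pS.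
have cL i : linear (fun m : M => (k m 0 i : A^o)).
  by move=> a u v; rewrite linearP !mxE.
exists n, (fun i => p (delta_mx 0 i)), (fun i => mk_linear (cL i)) => m /=.
rewrite -[LHS](kE m) [k m in LHS]row_sum_delta linear_sum.
by apply: eq_bigr => i _; rewrite linearZ.
Qed.

Definition fgproj_of_dual_basis M (h : dual_basis M) : fgproj :=
  FgProj (dual_basis_fin_gen h) (dual_basis_projective h).

Lemma dual_basis_zero : dual_basis 'rV[A]_0.
Proof.
exists 0%N, (fun=> 0), (fun=> GRing.null_fun _) => m.
by rewrite big_ord0 [m]thinmx0.
Qed.

Lemma dual_basis_one : dual_basis A^o.
Proof.
have idL : linear (id : A^o -> A^o) by [].
exists 1%N, (fun=> 1), (fun=> mk_linear idL) => m.
by rewrite big_ord1 /= [RHS]mulr1.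
Qed.

Lemma dual_basis_sum M N :
  dual_basis M -> dual_basis N -> dual_basis (M * N)%type.
Proof.
move=> [m [x [c cE]]] [n [y [d dE]]].
have cL i : linear (fun u : M * N => c i u.1) by move=> a u v; rewrite linearP.
have dL i : linear (fun u : M * N => d i u.2) by move=> a u v; rewrite linearP.
exists (m + n)%N, (fun k => match split k with
    inl i => (x i, 0) | inr j => (0, y j) end),
  (fun k => match split k with
    inl i => mk_linear (cL i) | inr j => mk_linear (dL j) end).
move=> [u v]; rewrite big_split_ord /=.
under eq_bigr => i _ do rewrite (unsplitK (inl i)) /=.
under [in X in _ + X]eq_bigr => i _ do rewrite (unsplitK (inr i)) /=.
have pairZ0 (a : A) (w : M) : a *: (w, 0 : N) = (a *: w, 0 : N).
  by congr pair; rewrite /= scaler0.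
have pair0Z (a : A) (w : N) : a *: (0 : M, w) = (0 : M, a *: w).
  by congr pair; rewrite /= scaler0.
have sum_pair k (F : 'I_k -> M) (G : 'I_k -> N) :
    \sum_i (F i, G i) = (\sum_i F i, \sum_i G i).
  by elim/big_rec3: _ => // i ? ? ? _ ->.
under eq_bigr => i _ do rewrite [_ *: _](_ : _ = (c i u *: x i, 0 : N)) ?pairZ0 //.
under [in X in _ + X]eq_bigr => i _ do
  rewrite [_ *: _](_ : _ = (0 : M, d i v *: y i)) ?pair0Z //.
by rewrite !sum_pair !big1_eq -cE -dE; congr pair; rewrite /= ?addr0 ?add0r.
Qed.

End Modules.

(* The tensor product: the free commutative monoid on M * N (finite formal    *)
(* sums, as sequences) modulo the congruence generated by the usual           *)
(* relations.  Since (m, n) + (- m, n) = 0 in the quotient, it is a group,    *)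
(* and hence the same as the quotient of the free abelian group.              *)
Section Tensor.
Variable A : comPzRingType.
Implicit Types M N P : lmodType A.

Section Def.
Variables M N : lmodType A.

Inductive tensor_rel : seq (M * N) -> seq (M * N) -> Prop :=
| tensor_rel_refl s : tensor_rel s s
| tensor_rel_sym s t : tensor_rel s t -> tensor_rel t s
| tensor_rel_trans t s u : tensor_rel s t -> tensor_rel t u -> tensor_rel s u
| tensor_rel_cat s s' t t' :
    tensor_rel s s' -> tensor_rel t t' -> tensor_rel (s ++ t) (s' ++ t')
| tensor_rel_catC s t : tensor_rel (s ++ t) (t ++ s)
| tensor_rel_0 n : tensor_rel [:: (0, n)] [::]
| tensor_rel_Dl m m' n : tensor_rel [:: (m + m', n)] [:: (m, n); (m', n)]
| tensor_rel_Dr m n n' : tensor_rel [:: (m, n + n')] [:: (m, n); (m, n')]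
| tensor_rel_Z a m n : tensor_rel [:: (a *: m, n)] [:: (m, a *: n)].

Definition tensor_relb s t := `[< tensor_rel s t >].

Lemma tensor_relb_equiv : equiv_class_of tensor_relb.
Proof.
split=> [s|s t|t s u].
- by apply/asboolP; apply: tensor_rel_refl.
- by apply/asboolP/asboolP; apply: tensor_rel_sym.
- move=> /asboolP st /asboolP tu.
  by apply/asboolP; apply: tensor_rel_trans st tu.
Qed.

Canonical tensor_equiv := EquivRelPack tensor_relb_equiv.
Canonical tensor_encModRel := defaultEncModRel tensor_relb.

Definition tensor := {eq_quot tensor_relb}.
HB.instance Definition _ := Choice.on tensor.
HB.instance Definition _ := EqQuotient.on tensor.

Definition tens (m : M) (n : N) : tensor := \pi_tensor [:: (m, n)].

Lemma tensor_eqP s t : \pi_tensor s = \pi_tensor t <-> tensor_rel s t.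
Proof. by split=> [/eqmodP/asboolP //|h]; apply/eqmodP/asboolP. Qed.

Definition tensor_zero : tensor := \pi_tensor [::].
Definition tensor_add (x y : tensor) : tensor := \pi_tensor (repr x ++ repr y).
Definition tensor_opp (x : tensor) : tensor :=
  \pi_tensor [seq (- p.1, p.2) | p <- repr x].

Lemma tensor_repr s : tensor_rel (repr (\pi_tensor s)) s.
Proof. by apply/tensor_eqP; rewrite reprK. Qed.

Lemma tensor_addE s t :
  tensor_add (\pi_tensor s) (\pi_tensor t) = \pi_tensor (s ++ t).
Proof. by apply/tensor_eqP/tensor_rel_cat; apply: tensor_repr. Qed.

Lemma tensor_addA : associative tensor_add.
Proof.
move=> x y z; rewrite -[x]reprK -[y]reprK -[z]reprK.
by rewrite !tensor_addE !reprK catA.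
Qed.

Lemma tensor_addC : commutative tensor_add.
Proof.
move=> x y; rewrite -[x]reprK -[y]reprK !tensor_addE.
exact/tensor_eqP/tensor_rel_catC.
Qed.

Lemma tensor_add0 : left_id tensor_zero tensor_add.
Proof. by move=> x; rewrite -[x]reprK tensor_addE. Qed.

Lemma tensor_addN : left_inverse tensor_zero tensor_opp tensor_add.
Proof.
move=> x; rewrite -[X in tensor_add _ X]reprK /tensor_opp tensor_addE.
apply/tensor_eqP; elim: (repr x) => [|[m n] s IHs] /=.
  exact: tensor_rel_refl.
rewrite -cat1s; apply: (tensor_rel_trans (t := [:: (- m, n)] ++ ([:: (m, n)] ++
  ([seq (- p.1, p.2) | p <- s] ++ s)))).
  apply: tensor_rel_cat; first exact: tensor_rel_refl.
  rewrite -cat1s !catA; apply: tensor_rel_cat; last exact: tensor_rel_refl.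
  exact: tensor_rel_catC.
rewrite catA -[[::]]cat0s; apply: tensor_rel_cat IHs => /=.
apply: tensor_rel_trans (tensor_rel_0 n); rewrite -(addNr m).
exact/tensor_rel_sym/tensor_rel_Dl.
Qed.

HB.instance Definition _ := GRing.isZmodule.Build tensor
  tensor_addA tensor_addC tensor_add0 tensor_addN.

Lemma tensDl m m' n : tens (m + m') n = tens m n + tens m' n.
Proof.
by rewrite [RHS]tensor_addE; apply/tensor_eqP; apply: tensor_rel_Dl.
Qed.

Lemma tensDr m n n' : tens m (n + n') = tens m n + tens m n'.
Proof.
by rewrite [RHS]tensor_addE; apply/tensor_eqP; apply: tensor_rel_Dr.
Qed.

Lemma tensZC a m n : tens (a *: m) n = tens m (a *: n).
Proof. by apply/tensor_eqP; apply: tensor_rel_Z. Qed.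

Lemma tens0l n : tens 0 n = 0.
Proof. by apply/tensor_eqP; apply: tensor_rel_0. Qed.

Lemma tens0r m : tens m 0 = 0.
Proof. by rewrite -(scale0r 0) -tensZC scale0r tens0l. Qed.

Lemma tensor_pi_sum s : \pi_tensor s = \sum_(p <- s) tens p.1 p.2.
Proof.
elim: s => [|[m n] s IHs]; first by rewrite big_nil.
by rewrite big_cons -IHs [RHS]tensor_addE.
Qed.

Lemma tensor_ind (Q : tensor -> Prop) :
  Q 0 -> (forall x y, Q x -> Q y -> Q (x + y)) ->
  (forall m n, Q (tens m n)) -> forall x, Q x.
Proof.
move=> Q0 QD Qt; move=> x; rewrite -[x]reprK tensor_pi_sum.
by elim/big_ind: _ => // p _; apply: Qt.
Qed.

Section Lift.
Variable Z : zmodType.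

Definition balanced (b : M -> N -> Z) : Prop :=
  [/\ forall m m' n, b (m + m') n = b m n + b m' n,
      forall m n n', b m (n + n') = b m n + b m n'
    & forall a m n, b (a *: m) n = b m (a *: n)].

Definition tens_lift (b : M -> N -> Z) (x : tensor) : Z :=
  \sum_(p <- repr x) b p.1 p.2.

Lemma tensor_rel_sum b s s' : balanced b -> tensor_rel s s' ->
  \sum_(p <- s) b p.1 p.2 = \sum_(p <- s') b p.1 p.2.
Proof.
case=> bDl bDr bZ; elim=> {s s'} //=.
- by move=> t u v _ -> _ ->.
- by move=> t t' u u' _ E _ E'; rewrite !big_cat /= E E'.
- by move=> t u; rewrite !big_cat /= addrC.
- move=> n; rewrite big_nil big_seq1 /=.
  by apply: (addrI (b 0 n)); rewrite -bDl !addr0.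
- by move=> m m' n; rewrite !big_cons !big_nil /= !addr0 bDl.
- by move=> m n n'; rewrite !big_cons !big_nil /= !addr0 bDr.
- by move=> a m n; rewrite !big_seq1 bZ.
Qed.

Lemma tens_lift_pi b s : balanced b ->
  tens_lift b (\pi_tensor s) = \sum_(p <- s) b p.1 p.2.
Proof. by move=> hb; apply: tensor_rel_sum hb (tensor_repr s). Qed.

Lemma tens_liftE b m n : balanced b -> tens_lift b (tens m n) = b m n.
Proof. by move=> hb; rewrite tens_lift_pi // big_seq1. Qed.

Lemma tens_lift0 b : balanced b -> tens_lift b 0 = 0.
Proof. by move=> hb; rewrite tens_lift_pi // big_nil. Qed.

Lemma tens_liftD b x y :
  balanced b -> tens_lift b (x + y) = tens_lift b x + tens_lift b y.
Proof.
move=> hb; rewrite -[x]reprK -[y]reprK.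
by rewrite [_ + _ in LHS]tensor_addE !tens_lift_pi // big_cat.
Qed.

Lemma eq_tens_lift b c x :
  (forall m n, b m n = c m n) -> tens_lift b x = tens_lift c x.
Proof. by move=> E; apply: eq_bigr => p _; rewrite E. Qed.

Lemma tens_lift_add b c x :
  tens_lift (fun m n => b m n + c m n) x = tens_lift b x + tens_lift c x.
Proof. exact: big_split. Qed.

End Lift.

Lemma tensor_scale_balanced a : balanced (fun m n => tens (a *: m) n).
Proof.
split=> [m m' n|m n n'|c m n]; first by rewrite scalerDr tensDl.
  by rewrite tensDr.
by rewrite scalerA mulrC -scalerA tensZC.
Qed.

Definition tensor_scale a (x : tensor) : tensor :=
  tens_lift (fun m n => tens (a *: m) n) x.

Let sbal := tensor_scale_balanced.

Lemma tensor_scalerA a b x :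
  tensor_scale a (tensor_scale b x) = tensor_scale (a * b) x.
Proof.
rewrite /tensor_scale; elim/tensor_ind: x => [|x y IHx IHy|m n].
- by rewrite !tens_lift0.
- by rewrite !tens_liftD ?IHx ?IHy.
- by rewrite !tens_liftE // scalerA.
Qed.

Lemma tensor_scale1r : left_id 1 tensor_scale.
Proof.
rewrite /tensor_scale; elim/tensor_ind=> [|x y IHx IHy|m n].
- by rewrite !tens_lift0.
- by rewrite !tens_liftD ?IHx ?IHy.
- by rewrite !tens_liftE // scale1r.
Qed.

Lemma tensor_scalerDr : right_distributive tensor_scale +%R.
Proof. by move=> a x y; rewrite /tensor_scale tens_liftD. Qed.

Lemma tensor_scalerDl x : {morph tensor_scale^~ x : a b / a + b}.
Proof.
move=> a b; rewrite /tensor_scale -tens_lift_add.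
by apply: eq_tens_lift => m n; rewrite scalerDl tensDl.
Qed.

HB.instance Definition _ := GRing.Zmodule_isLmodule.Build A tensor
  tensor_scalerA tensor_scale1r tensor_scalerDr tensor_scalerDl.

Lemma tensZl a m n : tens (a *: m) n = a *: tens m n.
Proof. by rewrite [RHS]tens_liftE. Qed.

Lemma tensZr a m n : tens m (a *: n) = a *: tens m n.
Proof. by rewrite -tensZC tensZl. Qed.

Lemma tens_balanced : balanced tens.
Proof. by split; [apply: tensDl | apply: tensDr | apply: tensZC]. Qed.

Lemma tens_lift_linear (P : lmodType A) (b : M -> N -> P) : balanced b ->
  (forall a m n, b (a *: m) n = a *: b m n) -> linear (tens_lift b).
Proof.
move=> hb bZ a x y; rewrite tens_liftD //; congr (_ + _).
elim/tensor_ind: x => [|u v IHu IHv|m n].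
- by rewrite scaler0 !tens_lift0 // scaler0.
- by rewrite scalerDr !tens_liftD // IHu IHv scalerDr.
- by rewrite -tensZl !tens_liftE.
Qed.

End Def.

Lemma tens_suml M N (I : Type) (r : seq I) (F : I -> M) n :
  tens (\sum_(i <- r) F i) n = \sum_(i <- r) tens (F i) n :> @tensor M N.
Proof.
elim: r => [|i r IHr]; first by rewrite !big_nil tens0l.
by rewrite !big_cons tensDl IHr.
Qed.

Lemma tens_sumr M N (I : Type) (r : seq I) m (F : I -> N) :
  tens m (\sum_(i <- r) F i) = \sum_(i <- r) tens m (F i) :> @tensor M N.
Proof.
elim: r => [|i r IHr]; first by rewrite !big_nil tens0r.
by rewrite !big_cons tensDr IHr.
Qed.

Lemma dual_basis_tensor M N :
  dual_basis M -> dual_basis N -> dual_basis (tensor M N).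
Proof.
move=> [m [x [c cE]]] [n [y [d dE]]].
pose b i j (u : M) (v : N) : A^o := (c i u : A) * (d j v : A).
have bB i j : balanced (b i j).
  split=> [u u' v|u v v'|a u v]; rewrite /b ?linearD ?mulrDl ?mulrDr //.
  by rewrite !linearZ /= mulrCA mulrA.
have bL i j : linear (tens_lift (b i j)).
  apply: tens_lift_linear => // a u v.
  by rewrite /b linearZ /= -mulrA.
pose I : finType := ('I_m * 'I_n)%type.
exists #|I|, (fun k : 'I_#|I| => tens (x (enum_val k).1) (y (enum_val k).2)),
  (fun k => mk_linear (bL (enum_val k).1 (enum_val k).2)) => t /=.
rewrite -(big_enum_val (fun k : I => tens_lift (b k.1 k.2) t *:
  tens (x k.1) (y k.2))) /=.
rewrite -(pair_bigA _ (fun i j => tens_lift (b i j) t *: tens (x i) (y j))) /=.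
elim/tensor_ind: t => [|s t IHs IHt|u v].
- rewrite big1 // => i _; rewrite big1 // => j _.
  by rewrite tens_lift0 // scale0r.
- rewrite [LHS](congr2 +%R IHs IHt) -big_split; apply: eq_bigr => i _ /=.
  rewrite -big_split; apply: eq_bigr => j _ /=.
  by rewrite tens_liftD // scalerDl.
- rewrite [in LHS](cE u) tens_suml; apply: eq_bigr => i _.
  rewrite [in LHS](dE v) tens_sumr; apply: eq_bigr => j _.
  by rewrite tens_liftE // tensZl tensZr scalerA.
Qed.

Definition tens_swap M N : tensor M N -> tensor N M :=
  tens_lift (fun u v => tens v u).

Lemma tens_swap_balanced M N : balanced (fun (u : M) (v : N) => tens v u).
Proof. by split=> *; rewrite ?tensDl ?tensDr ?tensZC. Qed.

Lemma tensorC M N : iso (tensor M N) (tensor N M).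
Proof.
have sK K L : cancel (@tens_swap K L) (@tens_swap L K).
  have bB := tens_swap_balanced; rewrite /tens_swap.
  elim/tensor_ind=> [|s t IHs IHt|u v].
  - by rewrite !tens_lift0.
  - by rewrite !tens_liftD // IHs IHt.
  - by rewrite !tens_liftE.
apply: (mk_iso (g := @tens_swap M N)) (sK _ _) (sK _ _).
apply: tens_lift_linear => [|a u v]; first exact: tens_swap_balanced.
exact: tensZr.
Qed.


Definition tens_map M M' N N' (g : {linear M -> M'}) (h : {linear N -> N'}) :
    tensor M N -> tensor M' N' := tens_lift (fun u v => tens (g u) (h v)).

Lemma tens_map_balanced M M' N N' (g : {linear M -> M'}) (h : {linear N -> N'}) :
  balanced (fun u v => tens (g u) (h v)).
Proof.
split=> [u u' v|u v v'|a u v]; rewrite ?linearD ?tensDl ?tensDr //.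
by rewrite !linearZ tensZC.
Qed.

Lemma tens_map_cancel M M' N N' (g : {linear M -> M'}) (h : {linear N -> N'})
    (g' : {linear M' -> M}) (h' : {linear N' -> N}) :
  cancel g g' -> cancel h h' -> cancel (tens_map g h) (tens_map g' h').
Proof.
move=> gK hK; have bB := tens_map_balanced; rewrite /tens_map.
elim/tensor_ind=> [|s t IHs IHt|u v].
- by rewrite !tens_lift0.
- by rewrite !tens_liftD // IHs IHt.
- by rewrite !tens_liftE // gK hK.
Qed.

Lemma tensor_iso M M' N N' :
  iso M M' -> iso N N' -> iso (tensor M N) (tensor M' N').
Proof.
move=> /iso_ex[g [g' [gK gK']]] /iso_ex[h [h' [hK hK']]].
apply: (mk_iso (g := tens_map g h)) (tens_map_cancel gK hK)
  (tens_map_cancel gK' hK').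
apply: tens_lift_linear => [|a u v]; first exact: tens_map_balanced.
by rewrite linearZ tensZl.
Qed.

Lemma tensorA M N P : iso (tensor M (tensor N P)) (tensor (tensor M N) P).
Proof.
pose b u v w : tensor (tensor M N) P := tens (tens u v) w.
have bB u : balanced (b u).
  by rewrite /b; split=> *; rewrite ?tensDr ?tensDl // tensZr tensZC.
have BB : balanced (fun u => tens_lift (b u)).
  split=> [u u' t|u t t'|a u t]; last 1 first.
  - elim/tensor_ind: t => [|s t IHs IHt|v w].
    + by rewrite scaler0 !tens_lift0.
    + by rewrite scalerDr !tens_liftD // IHs IHt.
    + by rewrite -tensZl !tens_liftE // /b tensZC.
  - rewrite -tens_lift_add; apply: eq_tens_lift => v w.
    by rewrite /b !tensDl.
  - by rewrite tens_liftD.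
pose c w u v : tensor M (tensor N P) := tens u (tens v w).
have cB w : balanced (c w).
  by rewrite /c; split=> *; rewrite ?tensDr ?tensDl ?tensDr // tensZC tensZl.
have CB : balanced (fun t w => tens_lift (c w) t).
  split=> [t t' w|t w w'|a t w]; first by rewrite tens_liftD.
  - rewrite -tens_lift_add; apply: eq_tens_lift => u v.
    by rewrite /c !tensDr.
  - elim/tensor_ind: t => [|s t IHs IHt|u v].
    + by rewrite scaler0 !tens_lift0.
    + by rewrite scalerDr !tens_liftD // IHs IHt.
    + by rewrite -tensZl !tens_liftE // /c tensZC -tensZl tensZC.
apply: (mk_iso (g := tens_lift (fun u => tens_lift (b u)))
  (h := tens_lift (fun t w => tens_lift (c w) t))).
- apply: tens_lift_linear => // a u t.
  elim/tensor_ind: t => [|s t IHs IHt|v w].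
  + by rewrite !tens_lift0 // scaler0.
  + by rewrite !tens_liftD // IHs IHt scalerDr.
  + by rewrite !tens_liftE // /b !tensZl.
- elim/tensor_ind=> [|s t IHs IHt|u t].
  + by rewrite !tens_lift0.
  + by rewrite !tens_liftD // IHs IHt.
  + rewrite (tens_liftE _ _ BB); elim/tensor_ind: t => [|s t IHs IHt|v w].
    * by rewrite !tens_lift0 // tens0r.
    * by rewrite !tens_liftD // IHs IHt tensDr.
    * by rewrite !tens_liftE.
- elim/tensor_ind=> [|s t IHs IHt|t w].
  + by rewrite !tens_lift0.
  + by rewrite !tens_liftD // IHs IHt.
  + rewrite (tens_liftE _ _ CB); elim/tensor_ind: t => [|s t IHs IHt|u v].
    * by rewrite !tens_lift0 // tens0l.
    * by rewrite !tens_liftD // IHs IHt tensDl.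
    * by rewrite !tens_liftE.
Qed.

Lemma tensor1 M : iso (tensor A^o M) M.
Proof.
have bB : balanced (fun (a : A^o) (u : M) => (a : A) *: u).
  split=> [a a' u|a u u'|c a u]; rewrite ?scalerDl ?scalerDr //.
  by rewrite scalerA [_ *: a]mulrC.
apply: (mk_iso (g := tens_lift (fun (a : A^o) (u : M) => (a : A) *: u))
  (h := tens (1 : A^o))).
- by apply: tens_lift_linear => // c a u; rewrite scalerA.
- elim/tensor_ind=> [|s t IHs IHt|a u].
  + by rewrite tens_lift0 // tens0r.
  + by rewrite tens_liftD // tensDr IHs IHt.
  + by rewrite tens_liftE // -tensZC; congr tens; rewrite [LHS]mulr1.
- by move=> u; rewrite tens_liftE // scale1r.
Qed.

Lemma tensor0 M : iso (tensor 'rV[A]_0 M) 'rV[A]_0.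
Proof.
apply: (mk_iso (g := GRing.null_fun _) (h := GRing.null_fun _)).
- by move=> a u v; rewrite scaler0 addr0.
- elim/tensor_ind=> //= [x y <- <-|m n]; first by rewrite addr0.
  by rewrite [m]thinmx0 tens0l.
- by move=> x; rewrite [x]thinmx0.
Qed.

Lemma tensor_suml M N P :
  iso (tensor (M * N)%type P) (tensor M P * tensor N P)%type.
Proof.
pose b (u : M * N) (w : P) : tensor M P * tensor N P :=
  (tens u.1 w, tens u.2 w).
have bB : balanced b.
  by rewrite /b; split=> *; rewrite ?tensDl ?tensDr ?tensZC.
pose c1 u w : tensor (M * N)%type P := tens (u, 0) w.
pose c2 v w : tensor (M * N)%type P := tens (0, v) w.
have pD1 (u u' : M) : (u + u', 0 : N) = (u, 0) + (u', 0).
  by congr pair; rewrite /= addr0.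
have pD2 (v v' : N) : (0 : M, v + v') = (0, v) + (0, v').
  by congr pair; rewrite /= addr0.
have pZ1 a (u : M) : (a *: u, 0 : N) = a *: (u, 0).
  by congr pair; rewrite /= scaler0.
have pZ2 a (v : N) : (0 : M, a *: v) = a *: (0, v).
  by congr pair; rewrite /= scaler0.
have c1B : balanced c1.
  by rewrite /c1; split=> *; rewrite ?pD1 ?tensDl ?tensDr ?pZ1 ?tensZC.
have c2B : balanced c2.
  by rewrite /c2; split=> *; rewrite ?pD2 ?tensDl ?tensDr ?pZ2 ?tensZC.
apply: (mk_iso (g := tens_lift b)
  (h := fun x => tens_lift c1 x.1 + tens_lift c2 x.2)).
- apply: tens_lift_linear => // a u w.
  by congr pair; rewrite /= tensZl.
- elim/tensor_ind=> [|s t IHs IHt|[u v] w].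
  + by rewrite !tens_lift0 //= addr0.
  + by rewrite tens_liftD //= !tens_liftD // addrACA IHs IHt.
  + rewrite tens_liftE //= !tens_liftE // -tensDl.
    by congr tens; congr pair; rewrite /= ?addr0 ?add0r.
- have h1 s : tens_lift b (tens_lift c1 s) = (s, 0).
    elim/tensor_ind: s => [|s t IHs IHt|u w].
    + by rewrite !tens_lift0.
    + rewrite !tens_liftD // IHs IHt.
      by congr pair; rewrite /= addr0.
    + by rewrite !tens_liftE // /b /= tens0l.
  have h2 s : tens_lift b (tens_lift c2 s) = (0, s).
    elim/tensor_ind: s => [|s t IHs IHt|u w].
    + by rewrite !tens_lift0.
    + rewrite !tens_liftD // IHs IHt.
      by congr pair; rewrite /= addr0.
    + by rewrite !tens_liftE // /b /= tens0l.
  case=> s t /=; rewrite tens_liftD // h1 h2.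
  by congr pair; rewrite /= ?addr0 ?add0r.
Qed.

Lemma sum_iso M M' N N' : iso M M' -> iso N N' -> iso (M * N)%type (M' * N')%type.
Proof.
move=> /iso_ex[g [g' [gK gK']]] /iso_ex[h [h' [hK hK']]].
apply: (mk_iso (g := fun x => (g x.1, h x.2)) (h := fun x => (g' x.1, h' x.2))).
- by move=> a u v; congr pair; rewrite /= linearP.
- by case=> x y /=; rewrite gK hK.
- by case=> x y /=; rewrite gK' hK'.
Qed.

Lemma sumC M N : iso (M * N)%type (N * M)%type.
Proof.
by apply: (mk_iso (g := fun x => (x.2, x.1)) (h := fun x => (x.2, x.1))) => //;
  case.
Qed.

Lemma sumA M N P : iso (M * (N * P))%type (M * N * P)%type.
Proof.
by apply: (mk_iso (g := fun x => (x.1, x.2.1, x.2.2))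
  (h := fun x => (x.1.1, (x.1.2, x.2)))) => //; [case=> ? [] | case=> [[]]].
Qed.

Lemma sum0 M : iso ('rV[A]_0 * M)%type M.
Proof.
apply: (mk_iso (g := snd) (h := pair 0)) => // -[x y].
by rewrite [x]thinmx0.
Qed.

End Tensor.
Arguments tens {A M N}.
Arguments tensor {A} M N.

(* The class of M is represented by the set of the kernels (n, K) of all the   *)
(* surjections A^n -> M: two finitely generated modules are isomorphic         *)
(* exactly when these sets agree (isocls_ofP).  This keeps the type of the     *)
(* classes small, as required by the universe levels of the ring structures.   *)
Section IsoClasses.
Variable A : comPzRingType.

Definition quotients (M : lmodType A) : set {n : nat & set 'rV[A]_n} :=
  [set c | exists2 p : {linear 'rV[A]_(tag c) -> M}, surj p
    & tagged c = [set v | p v = 0]%classic]%classic.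

Record isocls := IsoCls {
  isocls_set : set {n : nat & set 'rV[A]_n};
  _ : exists M : fgproj A, isocls_set = quotients M }.

Definition isocls_of (M : fgproj A) : isocls := IsoCls (ex_intro _ M erefl).

Lemma isocls_inj C D : isocls_set C = isocls_set D -> C = D.
Proof.
case: C D => [C hC] [D hD] /= E; subst D.
by congr IsoCls; apply: Prop_irrelevance.
Qed.

Lemma isocls_ofP (M N : fgproj A) : isocls_of M = isocls_of N <-> iso M N.
Proof.
split=> [/(congr1 isocls_set) /= E|/iso_ex[g [h [gK hK]]]].
  have [n [p pS]] := fin_gen_surj (fgproj_fin_gen M).
  have : quotients M (Tagged (fun n => set 'rV[A]_n) [set v | p v = 0]%classic).
    by exists p.
  rewrite E => -[/= q qS qE].
  have pq v w : p v = p w <-> q v = q w.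
    have pq0 u : p u = 0 <-> q u = 0.
      by have := congr1 (fun X : set _ => X u) qE => /= ->.
    have sub (K : lmodType A) (r : {linear 'rV[A]_n -> K}) :
        r v = r w <-> r (v - w) = 0.
      by rewrite linearB; split=> [->|/subr0_eq //]; rewrite subrr.
    by rewrite !sub.
  have [s sK] := choice pS; have [t tK] := choice qS.
  apply: (mk_iso (g := fun m => q (s m)) (h := fun m => p (t m))) => [a u v|m|m].
  - by rewrite -linearP; apply/pq; rewrite linearP !sK.
  - by rewrite -[RHS]sK; apply/pq; rewrite tK.
  - by rewrite -[RHS]tK; apply/pq; rewrite sK.
apply: isocls_inj; apply/seteqP; split=> -[n K] [/= p pS ->].
- have gpL : linear (g \o p) by move=> a u v /=; rewrite !linearP.
  exists (mk_linear gpL) => [y|].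
    by have [x xE] := pS (h y); exists x; rewrite /= xE hK.
  apply/seteqP; split=> v /= E; first by rewrite E linear0.
  by rewrite -[p v]gK E linear0.
- have hpL : linear (h \o p) by move=> a u v /=; rewrite !linearP.
  exists (mk_linear hpL) => [y|].
    by have [x xE] := pS (g y); exists x; rewrite /= xE gK.
  apply/seteqP; split=> v /= E; first by rewrite E linear0.
  by rewrite -[p v]hK E linear0.
Qed.

Lemma isocls_surj (C : isocls) : exists M, C = isocls_of M.
Proof. by case: C => C [M CE]; exists M; apply: isocls_inj. Qed.

Definition isocls_repr (C : isocls) : fgproj A := projT1 (cid (isocls_surj C)).

Lemma isocls_reprK C : isocls_of (isocls_repr C) = C.
Proof. by rewrite /isocls_repr; case: cid. Qed.

Lemma isocls_repr_iso (M : fgproj A) : iso (isocls_repr (isocls_of M)) M.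
Proof. by apply/isocls_ofP; rewrite isocls_reprK. Qed.

HB.instance Definition _ := gen_eqMixin isocls.
HB.instance Definition _ := gen_choiceMixin isocls.

Definition fgproj_zero : fgproj A :=
  fgproj_of_dual_basis (dual_basis_zero A).
Definition fgproj_one : fgproj A :=
  fgproj_of_dual_basis (dual_basis_one A).
Definition fgproj_sum (M N : fgproj A) : fgproj A := fgproj_of_dual_basis
  (dual_basis_sum (fgproj_dual_basis M) (fgproj_dual_basis N)).
Definition fgproj_tensor (M N : fgproj A) : fgproj A := fgproj_of_dual_basis
  (dual_basis_tensor (fgproj_dual_basis M) (fgproj_dual_basis N)).

Definition isocls_add (C D : isocls) : isocls :=
  isocls_of (fgproj_sum (isocls_repr C) (isocls_repr D)).
Definition isocls_mul (C D : isocls) : isocls :=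
  isocls_of (fgproj_tensor (isocls_repr C) (isocls_repr D)).

Lemma isocls_addE M N :
  isocls_add (isocls_of M) (isocls_of N) = isocls_of (fgproj_sum M N).
Proof. by apply/isocls_ofP/sum_iso; apply: isocls_repr_iso. Qed.

Lemma isocls_mulE M N :
  isocls_mul (isocls_of M) (isocls_of N) = isocls_of (fgproj_tensor M N).
Proof. by apply/isocls_ofP/tensor_iso; apply: isocls_repr_iso. Qed.

Lemma isocls_addA : associative isocls_add.
Proof.
move=> C D E; have [[M ->] [N ->]] := (isocls_surj C, isocls_surj D).
have [P ->] := isocls_surj E.
by rewrite !isocls_addE; apply/isocls_ofP/sumA.
Qed.

Lemma isocls_addC : commutative isocls_add.
Proof.
move=> C D; have [[M ->] [N ->]] := (isocls_surj C, isocls_surj D).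
by rewrite !isocls_addE; apply/isocls_ofP/sumC.
Qed.

Lemma isocls_add0 : left_id (isocls_of fgproj_zero) isocls_add.
Proof.
move=> C; have [M ->] := isocls_surj C.
by rewrite isocls_addE; apply/isocls_ofP/sum0.
Qed.

HB.instance Definition _ := GRing.isNmodule.Build isocls
  isocls_addA isocls_addC isocls_add0.

Lemma isocls_mulA : associative isocls_mul.
Proof.
move=> C D E; have [[M ->] [N ->]] := (isocls_surj C, isocls_surj D).
have [P ->] := isocls_surj E.
by rewrite !isocls_mulE; apply/isocls_ofP/tensorA.
Qed.

Lemma isocls_mulC : commutative isocls_mul.
Proof.
move=> C D; have [[M ->] [N ->]] := (isocls_surj C, isocls_surj D).
by rewrite !isocls_mulE; apply/isocls_ofP/tensorC.
Qed.

Lemma isocls_mul1 : left_id (isocls_of fgproj_one) isocls_mul.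
Proof.
move=> C; have [M ->] := isocls_surj C.
by rewrite isocls_mulE; apply/isocls_ofP/tensor1.
Qed.

Lemma isocls_mulDl : left_distributive isocls_mul isocls_add.
Proof.
move=> C D E; have [[M ->] [N ->]] := (isocls_surj C, isocls_surj D).
have [P ->] := isocls_surj E.
rewrite [isocls_add (isocls_of M) _]isocls_addE !isocls_mulE isocls_addE.
exact/isocls_ofP/tensor_suml.
Qed.

Lemma isocls_mul0 : left_zero (isocls_of fgproj_zero) isocls_mul.
Proof.
move=> C; have [M ->] := isocls_surj C.
by rewrite isocls_mulE; apply/isocls_ofP/tensor0.
Qed.

HB.instance Definition _ := GRing.Nmodule_isComPzSemiRing.Build isocls
  isocls_mulA isocls_mulC isocls_mul1 isocls_mulDl isocls_mul0.

Lemma isocls_ofD M N : isocls_of M + isocls_of N = isocls_of (fgproj_sum M N).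
Proof. exact: isocls_addE. Qed.

Lemma isocls_ofM M N :
  isocls_of M * isocls_of N = isocls_of (fgproj_tensor M N).
Proof. exact: isocls_mulE. Qed.

End IsoClasses.

(* The group completion of a commutative semiring S; [groth_diff a b] is the  *)
(* formal difference [a, b].                                                  *)
Section Grothendieck.
Variable S : comPzSemiRingType.

Definition groth_rel (p q : S * S) :=
  `[< exists k, p.1 + q.2 + k = q.1 + p.2 + k >].

Lemma groth_rel_equiv : equiv_class_of groth_rel.
Proof.
split=> [p|p q|q p r]; first by apply/asboolP; exists 0.
  by apply/asboolP/asboolP => -[k E]; exists k.
move=> /asboolP[k E] /asboolP[l F]; apply/asboolP; exists (q.1 + q.2 + k + l).
transitivity ((p.1 + q.2 + k) + (q.1 + r.2 + l)); first by ring.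
by rewrite E F; ring.
Qed.

Canonical groth_equiv := EquivRelPack groth_rel_equiv.
Canonical groth_encModRel := defaultEncModRel groth_rel.

Definition groth := {eq_quot groth_rel}.
HB.instance Definition _ := Choice.on groth.
HB.instance Definition _ := EqQuotient.on groth.

Definition groth_diff (a b : S) : groth := \pi_groth (a, b).

Lemma groth_diffP a b c d : groth_diff a b = groth_diff c d <->
  exists k, a + d + k = c + b + k.
Proof. by split=> [/eqmodP/asboolP //|h]; apply/eqmodP/asboolP. Qed.

Lemma groth_diffE (x : groth) : x = groth_diff (repr x).1 (repr x).2.
Proof. by rewrite /groth_diff -surjective_pairing reprK. Qed.

Lemma groth_diff_ex (x : groth) : exists a b, x = groth_diff a b.
Proof. by exists (repr x).1, (repr x).2; apply: groth_diffE. Qed.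

Lemma groth_repr a b : exists k, (repr (groth_diff a b)).1 + b + k =
  a + (repr (groth_diff a b)).2 + k.
Proof. by apply/groth_diffP; rewrite -groth_diffE. Qed.

Definition groth_zero : groth := groth_diff 0 0.
Definition groth_one : groth := groth_diff 1 0.
Definition groth_opp (x : groth) : groth := groth_diff (repr x).2 (repr x).1.
Definition groth_add (x y : groth) : groth :=
  groth_diff ((repr x).1 + (repr y).1) ((repr x).2 + (repr y).2).
Definition groth_mul (x y : groth) : groth :=
  groth_diff ((repr x).1 * (repr y).1 + (repr x).2 * (repr y).2)
             ((repr x).1 * (repr y).2 + (repr x).2 * (repr y).1).

Lemma groth_oppE a b : groth_opp (groth_diff a b) = groth_diff b a.
Proof.
apply/groth_diffP; have [k E] := groth_repr a b; exists k.
by rewrite [_ + a]addrC [b + _]addrC -E.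
Qed.

Lemma groth_addE a b c d :
  groth_add (groth_diff a b) (groth_diff c d) = groth_diff (a + c) (b + d).
Proof.
apply/groth_diffP; have [k E] := groth_repr a b; have [l F] := groth_repr c d.
move: (repr _) E (repr _) F => p E q F; exists (k + l).
transitivity ((p.1 + b + k) + (q.1 + d + l)); first by ring.
by rewrite E F; ring.
Qed.

Lemma groth_mulE a b c d : groth_mul (groth_diff a b) (groth_diff c d) =
  groth_diff (a * c + b * d) (a * d + b * c).
Proof.
apply/groth_diffP; have [k E] := groth_repr a b; have [l F] := groth_repr c d.
move: (repr _) E (repr _) F => p E q F.
exists (a * q.1 + b * q.2 + a * q.2 + b * q.1 + k * q.1 + k * q.2 + a * l + b * l).
transitivity ((p.1 + b + k) * q.1 + (a + p.2 + k) * q.2 +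
  a * (q.1 + d + l) + b * (c + q.2 + l)); first by ring.
transitivity ((a + p.2 + k) * q.1 + (p.1 + b + k) * q.2 +
  a * (c + q.2 + l) + b * (q.1 + d + l)); first by rewrite E F.
by ring.
Qed.

Lemma groth_addA : associative groth_add.
Proof.
move=> x y z; have [a [b ->]] := groth_diff_ex x.
have [c [d ->]] := groth_diff_ex y; have [e [g ->]] := groth_diff_ex z.
by rewrite !groth_addE !addrA.
Qed.

Lemma groth_addC : commutative groth_add.
Proof.
move=> x y; have [a [b ->]] := groth_diff_ex x.
have [c [d ->]] := groth_diff_ex y.
by rewrite !groth_addE [a + c]addrC [b + d]addrC.
Qed.

Lemma groth_add0 : left_id groth_zero groth_add.
Proof.
by move=> x; have [a [b ->]] := groth_diff_ex x; rewrite groth_addE !add0r.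
Qed.

Lemma groth_addN : left_inverse groth_zero groth_opp groth_add.
Proof.
move=> x; have [a [b ->]] := groth_diff_ex x.
rewrite groth_oppE groth_addE; apply/groth_diffP; exists 0.
by rewrite !addr0 add0r addrC.
Qed.

HB.instance Definition _ := GRing.isZmodule.Build groth
  groth_addA groth_addC groth_add0 groth_addN.

Lemma groth_mulA : associative groth_mul.
Proof.
move=> x y z; have [a [b ->]] := groth_diff_ex x.
have [c [d ->]] := groth_diff_ex y; have [e [g ->]] := groth_diff_ex z.
by rewrite !groth_mulE; congr groth_diff; ring.
Qed.

Lemma groth_mulC : commutative groth_mul.
Proof.
move=> x y; have [a [b ->]] := groth_diff_ex x.
have [c [d ->]] := groth_diff_ex y.
by rewrite !groth_mulE; congr groth_diff; ring.
Qed.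

Lemma groth_mul1 : left_id groth_one groth_mul.
Proof.
move=> x; have [a [b ->]] := groth_diff_ex x.
by rewrite groth_mulE; congr groth_diff; ring.
Qed.

Lemma groth_mulDl : left_distributive groth_mul groth_add.
Proof.
move=> x y z; have [a [b ->]] := groth_diff_ex x.
have [c [d ->]] := groth_diff_ex y; have [e [g ->]] := groth_diff_ex z.
rewrite [groth_add (groth_diff a b) _]groth_addE !groth_mulE groth_addE.
by congr groth_diff; ring.
Qed.

HB.instance Definition _ := GRing.Zmodule_isComPzRing.Build groth
  groth_mulA groth_mulC groth_mul1 groth_mulDl.

Lemma groth_diffN a b : - groth_diff a b = groth_diff b a.
Proof. exact: groth_oppE. Qed.

Lemma groth_diffD a b c d :
  groth_diff a b + groth_diff c d = groth_diff (a + c) (b + d).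
Proof. exact: groth_addE. Qed.

Lemma groth_diffM a b c d : groth_diff a b * groth_diff c d =
  groth_diff (a * c + b * d) (a * d + b * c).
Proof. exact: groth_mulE. Qed.

End Grothendieck.

Section GrothendieckMap.
Variables (S T : comPzSemiRingType) (g : {rmorphism S -> T}).

Definition groth_map (x : groth S) : groth T :=
  groth_diff (g (repr x).1) (g (repr x).2).

Lemma groth_mapE a b : groth_map (groth_diff a b) = groth_diff (g a) (g b).
Proof.
apply/groth_diffP; have [k E] := groth_repr a b; exists (g k).
by rewrite -!rmorphD E.
Qed.

Lemma groth_map_zmod_morphism : zmod_morphism groth_map.
Proof.
move=> x y; have [a [b ->]] := groth_diff_ex x.
have [c [d ->]] := groth_diff_ex y.
by rewrite groth_diffN groth_diffD !groth_mapE groth_diffN groth_diffD !rmorphD.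
Qed.

Lemma groth_map_monoid_morphism : monoid_morphism groth_map.
Proof.
split=> [|x y]; first by rewrite [LHS]groth_mapE rmorph1 rmorph0.
have [a [b ->]] := groth_diff_ex x; have [c [d ->]] := groth_diff_ex y.
by rewrite groth_diffM !groth_mapE groth_diffM !rmorphD !rmorphM.
Qed.

HB.instance Definition _ := GRing.isZmodMorphism.Build (groth S) (groth T)
  groth_map groth_map_zmod_morphism.
HB.instance Definition _ := GRing.isMonoidMorphism.Build (groth S) (groth T)
  groth_map groth_map_monoid_morphism.

End GrothendieckMap.

(* Base change.  [restr f] is B seen as an A-module through f; the B-module   *)
(* structure of M (x)_A B is b (m (x) c) = m (x) (b c).                       *)
Section BaseChange.
Variables (A B : comPzRingType) (f : {rmorphism A -> B}).

Definition restr : Type := B.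
HB.instance Definition _ := GRing.Zmodule.copy restr B.

Definition restr_scale (a : A) (b : restr) : restr := f a * (b : B).

Lemma restr_scalerA a b v :
  restr_scale a (restr_scale b v) = restr_scale (a * b) v.
Proof. by rewrite /restr_scale mulrA rmorphM. Qed.

Lemma restr_scale1r : left_id 1 restr_scale.
Proof. by move=> v; rewrite /restr_scale rmorph1 mul1r. Qed.

Lemma restr_scalerDr : right_distributive restr_scale +%R.
Proof. by move=> a u v; apply: mulrDr. Qed.

Lemma restr_scalerDl v : {morph restr_scale^~ v : a b / a + b}.
Proof. by move=> a b; rewrite /restr_scale rmorphD; apply: mulrDl. Qed.

HB.instance Definition _ := GRing.Zmodule_isLmodule.Build A restr
  restr_scalerA restr_scale1r restr_scalerDr restr_scalerDl.

Lemma restrZ (a : A) (b : restr) : a *: b = (f a * (b : B) : restr).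
Proof. by []. Qed.

Section Module.
Variable M : lmodType A.

Definition base_change : Type := tensor M restr.
HB.instance Definition _ := GRing.Zmodule.on base_change.

Definition btens (m : M) (b : B) : base_change := tens m (b : restr).

Definition base_change_scale (b : B) (x : base_change) : base_change :=
  tens_lift (fun m (c : restr) => btens m (b * c)) x.

Lemma btensDl m m' b : btens (m + m') b = btens m b + btens m' b.
Proof. exact: tensDl. Qed.

Lemma btensDr m b b' : btens m (b + b') = btens m b + btens m b'.
Proof. exact: tensDr. Qed.

Lemma btensZ a m b : btens (a *: m) b = btens m (f a * b).
Proof. exact: tensZC. Qed.

Lemma btens0l b : btens 0 b = 0. Proof. exact: tens0l. Qed.
Lemma btens0r m : btens m 0 = 0. Proof. exact: tens0r. Qed.

Lemma base_change_ind (Q : base_change -> Prop) :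
  Q 0 -> (forall x y, Q x -> Q y -> Q (x + y)) ->
  (forall m b, Q (btens m b)) -> forall x, Q x.
Proof. exact: tensor_ind. Qed.

(* [tens_lift] with [B] for [restr] *)
Section Lift.
Variables (Z : zmodType) (b : M -> B -> Z).

Definition bbalanced : Prop :=
  [/\ forall m m' c, b (m + m') c = b m c + b m' c,
      forall m c c', b m (c + c') = b m c + b m c'
    & forall a m c, b (a *: m) c = b m (f a * c)].

Definition btens_lift (x : base_change) : Z :=
  @tens_lift A M restr Z b x.

Hypothesis hb : bbalanced.

Let hb' : @balanced A M restr Z b.
Proof. by case: hb. Qed.

Lemma btens_liftE m c : btens_lift (btens m c) = b m c.
Proof. exact: (tens_liftE _ _ hb'). Qed.
Lemma btens_lift0 : btens_lift 0 = 0.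
Proof. exact: (tens_lift0 hb'). Qed.
Lemma btens_liftD x y : btens_lift (x + y) = btens_lift x + btens_lift y.
Proof. exact: (tens_liftD _ _ hb'). Qed.

End Lift.

Lemma base_change_scale_balanced b : bbalanced (fun m c => btens m (b * c)).
Proof.
split=> [m m' c|m c c'|a m c]; first exact: btensDl.
  by rewrite mulrDr btensDr.
by rewrite btensZ mulrCA.
Qed.

Let bscaleE b m c : base_change_scale b (btens m c) = btens m (b * c).
Proof. exact/btens_liftE/base_change_scale_balanced. Qed.
Let bscale0 b : base_change_scale b 0 = 0.
Proof. exact/btens_lift0/base_change_scale_balanced. Qed.
Let bscaleD b : {morph base_change_scale b : x y / x + y}.
Proof. move=> x y; exact/btens_liftD/base_change_scale_balanced. Qed.

Lemma base_change_scalerA b c x :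
  base_change_scale b (base_change_scale c x) = base_change_scale (b * c) x.
Proof.
elim/base_change_ind: x => [|x y IHx IHy|m d]; first by rewrite !bscale0.
  by rewrite !bscaleD IHx IHy.
by rewrite !bscaleE mulrA.
Qed.

Lemma base_change_scale1r : left_id 1 base_change_scale.
Proof.
elim/base_change_ind=> [|x y IHx IHy|m d]; first by rewrite !bscale0.
  by rewrite !bscaleD IHx IHy.
by rewrite !bscaleE mul1r.
Qed.

Lemma base_change_scalerDr : right_distributive base_change_scale +%R.
Proof. exact: bscaleD. Qed.

Lemma base_change_scalerDl x : {morph base_change_scale^~ x : b c / b + c}.
Proof.
move=> b c /=; elim/base_change_ind: x => [|x y IHx IHy|m d].
- by rewrite !bscale0 addr0.
- by rewrite !bscaleD IHx IHy addrACA.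
- by rewrite !bscaleE mulrDl btensDr.
Qed.

HB.instance Definition _ := GRing.Zmodule_isLmodule.Build B base_change
  base_change_scalerA base_change_scale1r base_change_scalerDr
  base_change_scalerDl.

Lemma btensZr b m c : btens m (b * c) = b *: btens m c.
Proof. by rewrite [RHS]bscaleE. Qed.

Lemma btens_lift_linear (P : lmodType B) (b : M -> B -> P) : bbalanced b ->
  (forall c m d, b m (c * d) = c *: b m d) -> linear (btens_lift b).
Proof.
move=> hb bZ a x y; rewrite btens_liftD //; congr (_ + _).
elim/base_change_ind: x => [|u v IHu IHv|m n].
- by rewrite scaler0 !btens_lift0 // scaler0.
- by rewrite scalerDr !btens_liftD // IHu IHv scalerDr.
- by rewrite -btensZr !btens_liftE.
Qed.

End Module.
Implicit Types M N : lmodType A.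

Lemma btens_suml M (I : Type) (r : seq I) (F : I -> M) b :
  btens (\sum_(i <- r) F i) b = \sum_(i <- r) btens (F i) b.
Proof. exact: tens_suml. Qed.

Lemma dual_basis_base_change M : dual_basis M -> dual_basis (base_change M).
Proof.
case=> n [x [c cE]].
pose b i (m : M) (d : B) : B^o := f (c i m : A) * d.
have bB i : bbalanced (b i).
  split=> [m m' d|m d d'|a m d]; rewrite /b.
  - by rewrite linearD rmorphD; apply: mulrDl.
  - exact: mulrDr.
  - by rewrite linearZ rmorphM mulrCA mulrA.
have bL i : linear (btens_lift (b i)).
  by apply: btens_lift_linear => // d m e; rewrite /b mulrCA.
exists n, (fun i => btens (x i) 1), (fun i => mk_linear (bL i)) => t /=.
elim/base_change_ind: t => [|s t IHs IHt|m d].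
- by rewrite big1 // => i _; rewrite btens_lift0 // scale0r.
- rewrite [LHS](congr2 +%R IHs IHt) -big_split; apply: eq_bigr => i _ /=.
  by rewrite btens_liftD // scalerDl.
- rewrite [in LHS](cE m) btens_suml; apply: eq_bigr => i _.
  by rewrite btens_liftE // -btensZr mulr1 btensZ.
Qed.

Lemma base_change_iso M N : iso M N -> iso (base_change M) (base_change N).
Proof.
move=> /iso_ex[g [h [gK hK]]].
have bB (K L : lmodType A) (p : {linear K -> L}) : bbalanced (fun m b => btens (p m) b).
  split=> [m m' b|m b b'|a m b]; rewrite ?linearD ?btensDl ?btensDr //.
  by rewrite linearZ btensZ.
have bK (K L : lmodType A) (p : {linear K -> L}) (q : {linear L -> K}) : cancel p q ->
    cancel (btens_lift (fun m b => btens (p m) b))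
           (btens_lift (fun m b => btens (q m) b)).
  move=> pK; elim/base_change_ind=> [|s t IHs IHt|m b].
  - by rewrite !btens_lift0.
  - by rewrite !btens_liftD // IHs IHt.
  - by rewrite !btens_liftE // pK.
apply: (mk_iso (g := btens_lift (fun m b => btens (g m) b))) (bK _ _ _ _ gK)
  (bK _ _ _ _ hK).
by apply: (btens_lift_linear (bB _ _ g)) => c m d; rewrite btensZr.
Qed.

Lemma base_change_zero : iso (base_change 'rV[A]_0) 'rV[B]_0.
Proof.
apply: (mk_iso (g := GRing.null_fun _) (h := GRing.null_fun _)).
- by move=> a u v; rewrite scaler0 addr0.
- elim/base_change_ind=> //= [x y <- <-|m n]; first by rewrite addr0.
  by rewrite [m]thinmx0 btens0l.
- by move=> x; rewrite [x]thinmx0.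
Qed.

Lemma base_change_one : iso (base_change A^o) B^o.
Proof.
pose b (a : A^o) (c : B) : B^o := f a * c.
have bB : bbalanced b.
  split=> [m m' d|m d d'|a m d]; rewrite /b.
  - by rewrite rmorphD; apply: mulrDl.
  - exact: mulrDr.
  - by rewrite rmorphM mulrCA mulrA.
apply: (mk_iso (g := btens_lift b) (h := btens (1 : A^o))).
- by apply: btens_lift_linear => // d m e; rewrite /b mulrCA.
- elim/base_change_ind=> [|s t IHs IHt|a c].
  + by rewrite btens_lift0 // btens0r.
  + by rewrite btens_liftD // btensDr IHs IHt.
  + by rewrite btens_liftE // -btensZ; congr btens; rewrite [LHS]mulr1.
- by move=> c; rewrite btens_liftE // /b rmorph1 mul1r.
Qed.

Lemma base_change_sum M N :
  iso (base_change (M * N)%type) (base_change M * base_change N)%type.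
Proof.
pose b (u : M * N) (c : B) : base_change M * base_change N :=
  (btens u.1 c, btens u.2 c).
have bB : bbalanced b.
  by rewrite /b; split=> *; rewrite ?btensDl ?btensDr ?btensZ.
pose c1 u c : base_change (M * N)%type := btens (u, 0) c.
pose c2 v c : base_change (M * N)%type := btens (0, v) c.
have pD1 (u u' : M) : (u + u', 0 : N) = (u, 0) + (u', 0).
  by congr pair; rewrite /= addr0.
have pD2 (v v' : N) : (0 : M, v + v') = (0, v) + (0, v').
  by congr pair; rewrite /= addr0.
have pZ1 a (u : M) : (a *: u, 0 : N) = a *: (u, 0).
  by congr pair; rewrite /= scaler0.
have pZ2 a (v : N) : (0 : M, a *: v) = a *: (0, v).
  by congr pair; rewrite /= scaler0.
have c1B : bbalanced c1.
  by rewrite /c1; split=> *; rewrite ?pD1 ?btensDl ?btensDr ?pZ1 ?btensZ.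
have c2B : bbalanced c2.
  by rewrite /c2; split=> *; rewrite ?pD2 ?btensDl ?btensDr ?pZ2 ?btensZ.
apply: (mk_iso (g := btens_lift b)
  (h := fun x => btens_lift c1 x.1 + btens_lift c2 x.2)).
- apply: btens_lift_linear => // a u w.
  by congr pair; rewrite /= btensZr.
- elim/base_change_ind=> [|s t IHs IHt|[u v] w].
  + by rewrite !btens_lift0 //= addr0.
  + by rewrite btens_liftD //= !btens_liftD // addrACA IHs IHt.
  + rewrite btens_liftE //= !btens_liftE // -btensDl.
    by congr btens; congr pair; rewrite /= ?addr0 ?add0r.
- have h1 s : btens_lift b (btens_lift c1 s) = (s, 0).
    elim/base_change_ind: s => [|s t IHs IHt|u w].
    + by rewrite !btens_lift0.
    + rewrite !btens_liftD // IHs IHt.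
      by congr pair; rewrite /= addr0.
    + by rewrite !btens_liftE // /b /= btens0l.
  have h2 s : btens_lift b (btens_lift c2 s) = (0, s).
    elim/base_change_ind: s => [|s t IHs IHt|u w].
    + by rewrite !btens_lift0.
    + rewrite !btens_liftD // IHs IHt.
      by congr pair; rewrite /= addr0.
    + by rewrite !btens_liftE // /b /= btens0l.
  case=> s t /=; rewrite btens_liftD // h1 h2.
  by congr pair; rewrite /= ?addr0 ?add0r.
Qed.

Lemma base_change_tensor M N :
  iso (base_change (tensor M N)) (tensor (base_change M) (base_change N)).
Proof.
pose T := tensor (base_change M) (base_change N).
pose b c (m : M) (n : N) : T := tens (btens m 1) (btens n c).
have bB c : balanced (b c).
  rewrite /b; split=> *; rewrite ?btensDl ?tensDl ?tensDr //.
  by rewrite !btensZ !btensZr tensZC.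
pose b' (t : tensor M N) c := tens_lift (b c) t.
have b'B : bbalanced b'.
  rewrite /b'; split=> [s t c|t c d|a t c]; first by rewrite tens_liftD.
    rewrite -tens_lift_add; apply: eq_tens_lift => m n.
    by rewrite /b btensDr tensDr.
  elim/tensor_ind: t => [|s t IHs IHt|m n].
  + by rewrite scaler0 !tens_lift0.
  + by rewrite scalerDr !tens_liftD // IHs IHt.
  + by rewrite -tensZr !tens_liftE // /b btensZ.
pose U := base_change (tensor M N).
pose g (m : M) c (n : N) d : U := btens (tens m n) (c * d).
have gB m c : bbalanced (g m c).
  rewrite /g; split=> [n n' d|n d d'|a n d].
  - by rewrite tensDr btensDl.
  - by rewrite mulrDr btensDr.
  - by rewrite tensZr btensZ mulrCA.
pose g' y m c := btens_lift (g m c) y.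
have g'B y : bbalanced (g' y).
  rewrite /g'; split=> [m m' c|m c c'|a m c];
    elim/base_change_ind: y => [|s t IHs IHt|n d];
    rewrite ?btens_lift0 ?addr0 // ?btens_liftD // ?btens_liftE // /g.
  - by rewrite IHs IHt addrACA.
  - by rewrite tensDl btensDl.
  - by rewrite IHs IHt addrACA.
  - by rewrite mulrDl btensDr.
  - by rewrite IHs IHt.
  - by rewrite tensZl btensZ mulrA.
pose g2 x y := btens_lift (g' y) x.
have g2B : balanced g2.
  rewrite /g2; split=> [x x' y|x y y'|c x y].
  - by rewrite btens_liftD.
  - elim/base_change_ind: x => [|s t IHs IHt|m d].
    + by rewrite !btens_lift0 // addr0.
    + by rewrite !btens_liftD // IHs IHt addrACA.
    + by rewrite !btens_liftE // /g' btens_liftD.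
  - elim/base_change_ind: x => [|s t IHs IHt|m d].
    + by rewrite scaler0 !btens_lift0.
    + by rewrite scalerDr !btens_liftD // IHs IHt.
    + rewrite -btensZr !btens_liftE // /g'.
      elim/base_change_ind: y => [|s t IHs IHt|n e].
      * by rewrite scaler0 !btens_lift0.
      * by rewrite scalerDr !btens_liftD // IHs IHt.
      * by rewrite -btensZr !btens_liftE // /g mulrCA mulrA.
apply: (mk_iso (g := btens_lift b') (h := tens_lift g2)).
- apply: btens_lift_linear => // c t d; rewrite /b'.
  elim/tensor_ind: t => [|s t IHs IHt|m n].
  + by rewrite !tens_lift0 // scaler0.
  + by rewrite !tens_liftD // IHs IHt scalerDr.
  + by rewrite !tens_liftE // /b btensZr tensZr.
- elim/base_change_ind=> [|s t IHs IHt|t c].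
  + by rewrite btens_lift0 // tens_lift0.
  + by rewrite btens_liftD // tens_liftD // IHs IHt.
  + rewrite btens_liftE // /b'; elim/tensor_ind: t => [|s t IHs IHt|m n].
    * by rewrite !tens_lift0 // btens0l.
    * by rewrite !tens_liftD // IHs IHt btensDl.
    * rewrite !tens_liftE // /g2 btens_liftE // /g' btens_liftE //.
      by rewrite /g mul1r.
- elim/tensor_ind=> [|s t IHs IHt|x y].
  + by rewrite tens_lift0 // btens_lift0.
  + by rewrite tens_liftD // btens_liftD // IHs IHt.
  + rewrite tens_liftE // /g2; elim/base_change_ind: x => [|s t IHs IHt|m c].
    * by rewrite !btens_lift0 // tens0l.
    * by rewrite !btens_liftD // IHs IHt tensDl.
    * rewrite btens_liftE // /g'; elim/base_change_ind: y => [|s t IHs IHt|n d].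
      - by rewrite !btens_lift0 // tens0r.
      - by rewrite !btens_liftD // IHs IHt tensDr.
      - rewrite !btens_liftE // /b' tens_liftE // /b.
        by rewrite btensZr -tensZC -btensZr mulr1.
Qed.

Definition fgproj_base_change (M : fgproj A) : fgproj B := fgproj_of_dual_basis
  (dual_basis_base_change (fgproj_dual_basis M)).

Definition isocls_map (C : isocls A) : isocls B :=
  isocls_of (fgproj_base_change (isocls_repr C)).

Lemma isocls_mapE (M : fgproj A) :
  isocls_map (isocls_of M) = isocls_of (fgproj_base_change M).
Proof. by apply/isocls_ofP/base_change_iso; apply: isocls_repr_iso. Qed.

Lemma isocls_map_nmod_morphism : nmod_morphism isocls_map.
Proof.
split=> [|C D]; first by rewrite isocls_mapE; apply/isocls_ofP/base_change_zero.
have [[M ->] [N ->]] := (isocls_surj C, isocls_surj D).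
rewrite [_ + _ in LHS]isocls_addE !isocls_mapE [RHS]isocls_addE.
exact/isocls_ofP/base_change_sum.
Qed.

Lemma isocls_map_monoid_morphism : monoid_morphism isocls_map.
Proof.
split=> [|C D]; first by rewrite isocls_mapE; apply/isocls_ofP/base_change_one.
have [[M ->] [N ->]] := (isocls_surj C, isocls_surj D).
rewrite [_ * _ in LHS]isocls_mulE !isocls_mapE [RHS]isocls_mulE.
exact/isocls_ofP/base_change_tensor.
Qed.

HB.instance Definition _ := GRing.isNmodMorphism.Build (isocls A) (isocls B)
  isocls_map isocls_map_nmod_morphism.
HB.instance Definition _ := GRing.isMonoidMorphism.Build (isocls A) (isocls B)
  isocls_map isocls_map_monoid_morphism.

End BaseChange.

Definition K0 (A : comPzRingType) : comPzRingType := groth (isocls A).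

Definition K0_diff (A : comPzRingType) (M N : fgproj A) : K0 A :=
  groth_diff (isocls_of M) (isocls_of N).

Definition K0_map (A B : comPzRingType) (f : {rmorphism A -> B}) :
  {rmorphism K0 A -> K0 B} := groth_map (isocls_map f).

Lemma K0_mapE (A B : comPzRingType) (f : {rmorphism A -> B}) (M N : fgproj A) :
  K0_map f (K0_diff M N) =
  K0_diff (fgproj_base_change f M) (fgproj_base_change f N).
Proof. by rewrite [LHS]groth_mapE /= !isocls_mapE. Qed.

Lemma K0_diff_surj (A : comPzRingType) (x : K0 A) :
  exists M N : fgproj A, x = K0_diff M N.
Proof.
have [C [D ->]] := groth_diff_ex x.
by have [[M ->] [N ->]] := (isocls_surj C, isocls_surj D); exists M, N.
Qed.

Lemma K0_diffP (A : comPzRingType) (M N M' N' : fgproj A) :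
  K0_diff M N = K0_diff M' N' <-> exists P : fgproj A,
    iso ((M * N') * P)%type ((M' * N) * P)%type.
Proof.
split=> [/groth_diffP[C]|[P h]].
  have [P ->] := isocls_surj C.
  rewrite (isocls_ofD M) (isocls_ofD M') (isocls_ofD (fgproj_sum M N')).
  by rewrite isocls_ofD => /isocls_ofP; exists P.
apply/groth_diffP; exists (isocls_of P).
rewrite (isocls_ofD M) (isocls_ofD M') (isocls_ofD (fgproj_sum M N')).
by rewrite isocls_ofD; apply/isocls_ofP.
Qed.

(* Main.v *)
(* A finitely generated projective B-module is the image of an idempotent
   matrix P, and e = 1 - det (1 - P) is the idempotent cutting out its
   support.  As B is semilocal, there are a row v = v P and a column u = P u
   with v u = e, so that P = u v + Q with Q an idempotent orthogonal to u v.
   The local rank of Q is smaller than that of P wherever the latter is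
   positive, so iterating shows that the module is a direct sum of modules
   e_i B with e_i idempotent; lifting the e_i to A shows that the module is
   extended from A, and K_0(f) is surjective. *)

From HB Require Import structures.
Require Import Defs.
From mathcomp Require Import all_boot all_algebra.
From mathcomp Require Import ring.
From mathcomp Require Import boolp classical_sets cardinality.

Set Implicit Arguments.
Unset Strict Implicit.
Unset Printing Implicit Defensive.

Import GRing.Theory.
Local Open Scope ring_scope.

(** * Ideals and maximal ideals of a commutative ring *)

Section Ideals.
Variable B : comPzRingType.
Implicit Types (I m : set B) (s : seq (set B)).

Lemma ideal_opp I x : is_ideal I -> I x -> I (- x).
Proof. by case=> _ _ IM Ix; rewrite -mulN1r; apply: IM. Qed.

Lemma ideal_mulr I a x : is_ideal I -> I x -> I (x * a).
Proof. by case=> _ _ IM Ix; rewrite mulrC; apply: IM. Qed.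

Lemma ideal_sum I (J : Type) (r : seq J) (P : pred J) (F : J -> B) :
  is_ideal I -> (forall j, P j -> I (F j)) -> I (\sum_(j <- r | P j) F j).
Proof. by case=> I0 ID _ IF; apply: big_ind. Qed.

(** Congruences modulo [I] are stable under products and sums, hence pass through the Leibniz
    expansion. *)
Lemma ideal_subr_det I n (M N : 'M[B]_n) : is_ideal I ->
  (forall i j, I (M i j - N i j)) -> I (\det M - \det N).
Proof.
move=> hI IMN; have [I0 ID IM] := hI.
have prodI (J : finType) (F G : J -> B) :
    (forall j, I (F j - G j)) -> I (\prod_j F j - \prod_j G j).
  move=> IFG; apply: (big_ind2 (fun x y => I (x - y))) => [|x x' y y' Ix Iy|//].
    by rewrite subrr.
  have -> : x * y - x' * y' = y * (x - x') + x' * (y - y') by ring.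
  by apply: ID; apply: IM.
rewrite -sumrB; apply: ideal_sum => // p _.
by rewrite -mulrBr; apply: IM; apply: prodI.
Qed.

Lemma maximal_ideal1 m : is_maximal_ideal m -> ~ m 1.
Proof.
case=> -[_ _ mM] mT _ m1; apply: mT; apply/seteqP; split=> // x _.
by rewrite -[x]mulr1; apply: mM.
Qed.

(** The ideal [J], which is m + aB, contains [m] and also [a], so by maximality it contains 1. *)
Lemma maximal_ideal_inverse m a : is_maximal_ideal m -> ~ m a ->
  exists r, m (1 - r * a).
Proof.
move=> hm ma; have [hI mT mmax] := hm; have [m0 mD mM] := hI.
pose J : set B := fun z => exists r, m (z - r * a).
have hJ : is_ideal J.
  split=> [|x y [r mx] [t my]|c x [r mx]].
  - by exists 0; rewrite mul0r subr0.
  - by exists (r + t); rewrite mulrDl opprD addrACA; apply: mD.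
  - by exists (c * r); rewrite -mulrA -mulrBr; apply: mM.
have mJ : (m `<=` J)%classic by move=> z mz; exists 0; rewrite mul0r subr0.
case: (mmax J hJ mJ) => [JE|JT]; last by have : J 1 by rewrite JT.
by case: ma; rewrite -JE; exists 1; rewrite mul1r subrr.
Qed.

Lemma maximal_ideal_prime m a b :
  is_maximal_ideal m -> m (a * b) -> m a \/ m b.
Proof.
move=> hm mab; have [[_ mD mM] _ _] := hm.
case: (pselect (m a)) => [|ma]; [by left | right].
have [r mr] := maximal_ideal_inverse hm ma.
have -> : b = b * (1 - r * a) + r * (a * b) by ring.
by apply: mD; apply: mM.
Qed.

(** Krull's theorem, by Zorn's lemma applied to the ideals containing [I] but not 1. *)
Lemma maximal_ideal_ex (I : set B) : is_ideal I -> ~ I 1 ->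
  exists2 m, is_maximal_ideal m & (I `<=` m)%classic.
Proof.
move=> hI I1; have [I0 _ _] := hI.
(* The empty set is let in, as the union of the empty chain. *)
pose P : set (set B) :=
  fun J => nonempty J -> [/\ is_ideal J, (I `<=` J)%classic & ~ J 1].
have [F FP Ftot|m [Pm mmax]] := @Zorn_bigcup B P.
  case=> z [J0 FJ0 J0z].
  have FI J x : F J -> J x -> [/\ is_ideal J, (I `<=` J)%classic & ~ J 1].
    by move=> FJ Jx; apply: FP => //; exists x.
  split=> [|x Ix|[J FJ J1]]; last by have [_ _] := FI J 1 FJ J1.
    split.
    - by exists J0 => //; have [[]] := FI J0 z FJ0 J0z.
    - move=> x y [J FJ Jx] [K FK Ky].
      have [[_ JD _] _ _] := FI J x FJ Jx; have [[_ KD _] _ _] := FI K y FK Ky.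
      case: (Ftot J K FJ FK) => [JK|KJ].
        by exists K => //; apply: KD => //; apply: JK.
      by exists J => //; apply: JD => //; apply: KJ.
    - move=> a x [J FJ Jx]; exists J => //.
      by have [[_ _ JM] _ _] := FI J x FJ Jx; apply: JM.
  by exists J0 => //; have [_ IJ _] := FI J0 z FJ0 J0z; apply: IJ.
(* Were [m] empty, the strictly larger [I] would contradict its maximality. *)
have m_ex : nonempty m.
  apply: contrapT => m0; apply: (mmax I); last by move=> _; split.
  split=> [x mx|Im]; first by case: m0; exists x.
  by apply: m0; exists 0; apply: Im.
have [hm Im m1] := Pm m_ex.
exists m => //; split=> // [mT|J hJ mJ]; first by apply: m1; rewrite mT.
case: (pselect (J 1)) => [J1|J1]; [right|left].
  apply/seteqP; split=> // x _; rewrite -[x]mulr1.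
  by have [_ _ JM] := hJ; apply: JM.
apply: contrapT => JE; apply: (mmax J).
  by split=> // Jm; apply: JE; apply/seteqP.
by move=> _; split=> // x Ix; apply/mJ/Im.
Qed.

Lemma unit_of_maximal (u : B) :
  (forall m, is_maximal_ideal m -> ~ m u) -> exists w, w * u = 1.
Proof.
move=> um; apply: contrapT => noinv.
pose I : set B := fun z => exists w, w * u = z.
have hI : is_ideal I.
  split=> [|x y [w <-] [w' <-]|a x [w <-]].
  - by exists 0; rewrite mul0r.
  - by exists (w + w'); rewrite mulrDl.
  - by exists (a * w); rewrite mulrA.
have [m hm Im] := maximal_ideal_ex hI noinv.
by case: (um m hm); apply: Im; exists 1; rewrite mul1r.
Qed.

(** Distinct maximal ideals are not nested, so each m' in [s] other than [m] has an element outside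
    [m]; the product of these elements stays outside [m], which is prime. *)
Lemma maximal_ideal_separate s m :
  (forall m', m' \in s -> is_maximal_ideal m') -> is_maximal_ideal m ->
  exists2 b, ~ m b & forall m', m' \in s -> m' != m -> m' b.
Proof.
move=> + hm; elim: s => [|m' s IHs] hs;
  first by exists 1 => //; apply: maximal_ideal1.
have [|b mb bs] := IHs; first by move=> m2 m2s; apply: hs; rewrite inE m2s orbT.
have hm' : is_maximal_ideal m' by apply: hs; rewrite inE eqxx.
have [m'E|m'm] := eqVneq m' m.
  by exists b => // m2; rewrite inE => /orP[/eqP-> /eqP//|]; apply: bs.
have [a m'a ma] : exists2 a, m' a & ~ m a.
  apply: contrapT => no_a.
  have sub : (m' `<=` m)%classic.
    by move=> x m'x; apply: contrapT => mx; apply: no_a; exists x.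
  have [_ _ m'max] := hm'; have [hI mT _] := hm.
  by case: (m'max m hI sub) => // E; rewrite E eqxx in m'm.
exists (a * b) => [mab|m2].
  by case: (maximal_ideal_prime hm mab).
rewrite inE => /orP[/eqP-> _|m2s m2m].
  by apply: ideal_mulr m'a; case: hm'.
have [[_ _ m2M] _ _] : is_maximal_ideal m2 by apply: hs; rewrite inE m2s orbT.
by apply: m2M; apply: bs.
Qed.

End Ideals.

(** * Idempotent matrices, and their diagonal form when there are finitely many maximal ideals *)

Section IdempotentMatrices.
Variable B : comPzRingType.

(** Padding with zeros makes both factors square, the left one with a zero column. *)
Lemma det_mulmx_lt m n (X : 'M[B]_(m, n)) (Y : 'M_(n, m)) :
  (n < m)%N -> \det (X *m Y) = 0.
Proof.
move=> lt_nm; have [k mE] : exists k, m = (n + k.+1)%N.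
  by exists (m - n.+1)%N; rewrite addnS -addSn subnKC.
subst m.
have -> : X *m Y = row_mx X (0 : 'M_(_, k.+1)) *m col_mx Y 0.
  by rewrite mul_row_col mul0mx addr0.
rewrite det_mulmx (expand_det_col _ (rshift n ord0)) big1 ?mul0r // => i _.
by rewrite row_mxEr mxE mul0r.
Qed.

Lemma det_idempotent n (P : 'M[B]_n) :
  P *m P = P -> \det P * \det P = \det P.
Proof. by move=> PP; rewrite -det_mulmx PP. Qed.

Lemma compl_idempotent_mx n (P : 'M[B]_n) :
  P *m P = P -> (1%:M - P) *m (1%:M - P) = 1%:M - P.
Proof. by move=> PP; rewrite mulmxBl mul1mx mulmxBr mulmx1 PP subrr subr0. Qed.

(** The determinant of 1 - P is adj(1 - P) (1 - P), and (1 - P) P = 0. *)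
Lemma det_compl_idempotent_scale n (P : 'M[B]_n) :
  P *m P = P -> \det (1%:M - P) *: P = 0.
Proof.
move=> PP; rewrite -mul_scalar_mx -mul_adj_mx -mulmxA mulmxBl mul1mx PP subrr.
by rewrite mulmx0.
Qed.

(* For each maximal ideal [m] not containing [e] choose vectors with
   [X_m P Y_m] outside [m] but with [X_m], [Y_m] vanishing modulo the other
   ones; their sums [X], [Y] make [X P Y + (1 - e)] a unit. *)
Lemma idempotent_mx_peel n (P : 'M[B]_n) :
  finite_set [set I : set B | is_maximal_ideal I]%classic -> P *m P = P ->
  exists e (v : 'rV_n) (u : 'cV_n),
    [/\ e * e = e, e *: P = P, v *m P = v, P *m u = u & v *m u = e%:M].
Proof.
move=> /finite_seqP[s0 sE] PP.
have [s us hs] : exists2 s : seq (set B), uniq s &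
    forall m, m \in s <-> is_maximal_ideal m.
  exists (undup s0) => [|m]; first exact: undup_uniq.
  by have := congr1 (fun X : set (set B) => X m) sE => /= ->; rewrite mem_undup.
pose e := 1 - \det (1%:M - P).
have ee : e * e = e.
  have dd := det_idempotent (compl_idempotent_mx PP).
  by rewrite /e; move: (\det _) dd => d dd; ring: dd.
have eP : e *: P = P.
  by rewrite scalerBl scale1r det_compl_idempotent_scale // subr0.
have hsI m : m \in s -> is_ideal m by move=> /hs[].
have /choice[XY XYP] : forall m, exists XY : 'rV[B]_n * 'cV[B]_n, m \in s ->
    [/\ ~ m e -> ~ m ((XY.1 *m P *m XY.2) 0 0),
      forall m', m' \in s -> m' != m -> forall i, m' (XY.1 0 i)
    & forall m', m' \in s -> m' != m -> forall i, m' (XY.2 i 0)].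
  move=> m; case: (pselect (m \in s /\ ~ m e)) => [[ms me]|no]; last first.
    exists (0, 0) => ms; split=> [me|m' m's _ i|m' m's _ i]; first by case: no.
      by rewrite mxE; case: (hsI m' m's).
    by rewrite mxE; case: (hsI m' m's).
  have hm : is_maximal_ideal m by apply/hs.
  have hI : is_ideal m by apply: hsI.
  (* If all entries of [P] lay in [m], then det(1 - P) would be 1 modulo [m], putting [e] in [m]. *)
  have [i [j mP]] : exists i j, ~ m (P i j).
    apply: contrapT => noP; apply: me.
    rewrite /e -[X in X - _](det1 _ n); apply: ideal_subr_det => // i j.
    rewrite !mxE opprB addrC subrK.
    by apply: contrapT => mP; apply: noP; exists i, j.
  have [b mb bs] := maximal_ideal_separate (fun m' => proj1 (hs m')) hm.
  exists (b *: delta_mx 0 i, b *: delta_mx j 0) => _; split=> /=.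
  - move=> _; rewrite -scalemxAl -scalemxAl -scalemxAr -rowE -colE !mxE.
    by case/(maximal_ideal_prime hm) => // /(maximal_ideal_prime hm)[].
  - move=> m' m's m'm k; rewrite !mxE.
    by apply: ideal_mulr; [apply: hsI | apply: bs].
  - move=> m' m's m'm k; rewrite !mxE.
    by apply: ideal_mulr; [apply: hsI | apply: bs].
pose X := \sum_(m <- s) (XY m).1.
pose Y := \sum_(m <- s) (XY m).2.
pose c := (X *m P *m Y) 0 0.
have cE : X *m P *m Y = c%:M by rewrite [LHS]mx11_scalar.
have ec : e * c = c.
  have -> : e * c = (e *: (X *m P *m Y)) 0 0 by rewrite mxE.
  by rewrite scalemxAl scalemxAr eP.
have mc m : m \in s -> ~ m e -> ~ m c.
  move=> ms me; have [mXY _ _] := XYP m ms; move=> mc; apply: mXY => //.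
  have hI := hsI m ms; have [m0 mD mM] := hI.
  pose X' := \sum_(m' <- s | m' != m) (XY m').1.
  pose Y' := \sum_(m' <- s | m' != m) (XY m').2.
  have XE : X = (XY m).1 + X' by rewrite /X (bigD1_seq m).
  have YE : Y = (XY m).2 + Y' by rewrite /Y (bigD1_seq m).
  have mX' i : m (X' 0 i).
    rewrite summxE big_seq_cond; apply: ideal_sum => // m' /andP[m's m'm].
    by have [_ + _] := XYP m' m's; apply; rewrite // eq_sym.
  have mY' i : m (Y' i 0).
    rewrite summxE big_seq_cond; apply: ideal_sum => // m' /andP[m's m'm].
    by have [_ _ +] := XYP m' m's; apply; rewrite // eq_sym.
  (* Modulo [m] only the term coming from [m] itself survives. *)
  have E : X *m P *m Y = (XY m).1 *m P *m (XY m).2 +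
      ((XY m).1 *m P *m Y' + X' *m (P *m Y)).
    by rewrite {1}XE !mulmxDl -[X' *m P *m Y]mulmxA {1}YE mulmxDr addrA.
  have -> : ((XY m).1 *m P *m (XY m).2) 0 0 =
      c - (((XY m).1 *m P *m Y') 0 0 + (X' *m (P *m Y)) 0 0).
    have entryD (M N : 'M[B]_1) : (M + N) 0 0 = M 0 0 + N 0 0 by rewrite mxE.
    by rewrite /c E !entryD addrK.
  apply: (mD) => //; apply: ideal_opp => //.
  apply: mD; rewrite mxE; apply: ideal_sum => // i _; first exact: mM.
  exact: ideal_mulr.
(* If [e] lies in [m], so does c = e c, and the sum is 1 modulo [m]; otherwise e times the sum is
   [c], which avoids [m]. *)
have [m hm|w wE] := @unit_of_maximal B (c + (1 - e)).
  have ms : m \in s by apply/hs.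
  have [m0 mD mM] := hsI m ms.
  case: (pselect (m e)) => [me mu|me mu].
    apply: (maximal_ideal1 hm).
    have -> : 1 = c + (1 - e) + (1 - c) * e by ring: ec.
    by apply: mD => //; apply: mM.
  have : m (e * (c + (1 - e))) by apply: mM.
  have -> : e * (c + (1 - e)) = c by ring: ec ee.
  exact: mc.
(* Multiplying w (c + (1 - e)) = 1 by [e] gives w c = e, hence the factor [w]. *)
exists e, (w *: (X *m P)), (P *m Y); split=> //.
- by rewrite -scalemxAl -mulmxA PP.
- by rewrite mulmxA PP.
- rewrite -scalemxAl mulmxA -[X *m P *m P]mulmxA PP cE scale_scalar_mx.
  by congr (_%:M); rewrite -[RHS]mulr1 -wE; ring: ec ee.
Qed.

(* The determinantal hypothesis says that [P] has rank at most [r] at every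
   prime; it is stated for all [X P Y] so as to be independent of bases. *)
Lemma idempotent_mx_diag n r (P : 'M[B]_n) :
  finite_set [set I : set B | is_maximal_ideal I]%classic -> P *m P = P ->
  (forall (X : 'M_(r.+1, n)) (Y : 'M_(n, r.+1)), \det (X *m P *m Y) = 0) ->
  exists (d : 'rV_r) (U : 'M_(n, r)) (V : 'M_(r, n)),
    [/\ forall i, d 0 i * d 0 i = d 0 i, U *m V = P, V *m U = diag_mx d,
        P *m U = U & V *m P = V].
Proof.
move=> finB; elim: r P => [|r IHr] P PP rkP.
  (* For r = 0 the hypothesis concerns 1 x 1 determinants; unit vectors read off the entries of
     [P]. *)
  have P0 : P = 0.
    apply/matrixP=> i j; have := rkP (delta_mx 0 i) (delta_mx j 0).
    by rewrite -rowE -colE [col _ _]mx11_scalar det_scalar1 !mxE.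
  exists 0, 0, 0; rewrite P0 !(mul0mx, mulmx0, linear0); split=> // -[] //.
have [e [v [u [ee eP vP Pu vu]]]] := idempotent_mx_peel finB PP.
have ve : e *: v = v by rewrite -vP scalemxAr eP.
have eu : e *: u = u by rewrite -Pu scalemxAl eP.
pose Q := P - u *m v.
have PQ : P *m Q = Q by rewrite mulmxBr PP mulmxA Pu.
have QP : Q *m P = Q by rewrite mulmxBl PP -mulmxA vP.
have vQ : v *m Q = 0.
  by rewrite mulmxBr vP mulmxA vu mul_scalar_mx ve subrr.
have Qu : Q *m u = 0.
  by rewrite mulmxBl Pu -mulmxA vu mul_mx_scalar eu subrr.
have QQ : Q *m Q = Q by rewrite {1}/Q mulmxBl PQ -mulmxA vQ mulmx0 subr0.
have eQ : e *: Q = Q by rewrite -PQ scalemxAl eP.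
(* Bordering X Q by [v] and Q Y by [u] gives a block triangular matrix with determinant e det(X Q
   Y), which vanishes by [rkP]. As e Q = Q, a factor [e] can be pulled out of det(X Q Y), so this
   determinant is itself 0. *)
have rkQ (X : 'M_(r.+1, n)) (Y : 'M_(n, r.+1)) : \det (X *m Q *m Y) = 0.
  have : \det (col_mx v (X *m Q) *m P *m row_mx u (Q *m Y)) = 0 by exact: rkP.
  rewrite mul_col_mx mul_col_row vP vu -[X *m Q *m P]mulmxA QP !mulmxA vQ.
  rewrite mul0mx -[X *m Q *m Q]mulmxA QQ det_lblock det_scalar1 => eD.
  rewrite -{1}eQ -scalemxAr -scalemxAl detZ exprS -mulrA mulrCA.
  by rewrite eD mulr0.
have [d [U [V [dd UV VU QU VQ]]]] := IHr Q QQ rkQ.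
rewrite -[r.+1]/(1 + r)%N.
exists (row_mx e%:M d), (row_mx u U), (col_mx v V); split.
- move=> i; rewrite -(splitK i); case: (split i) => j /=.
    by rewrite row_mxEl ord1 !mxE mulr1n.
  by rewrite row_mxEr.
- by rewrite mul_row_col UV addrC subrK.
- rewrite mul_col_row vu VU diag_mx_row -{1}QU mulmxA vQ mul0mx.
  rewrite -{1}VQ -mulmxA Qu mulmx0; congr block_mx.
  by apply/matrixP=> i j; rewrite !ord1 !mxE mulr1n.
- by rewrite mul_mx_row Pu -{1}QU mulmxA PQ QU.
- by rewrite mul_col_mx vP -{1}VQ -mulmxA QP VQ.
Qed.

End IdempotentMatrices.

(** * Projective modules as images of idempotent matrices *)

Section Retracts.
Variable A : comPzRingType.

(** Says that [M] is isomorphic to the image of [Q] acting on row vectors, without forming that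
    image. *)
Definition retract (M : lmodType A) n (Q : 'M[A]_n) : Prop :=
  exists (g : {linear M -> 'rV[A]_n}) (p : {linear 'rV[A]_n -> M}),
    cancel g p /\ forall v, g (p v) = v *m Q.

Lemma retract_idempotent (M : lmodType A) n (Q : 'M[A]_n) :
  retract M Q -> Q *m Q = Q.
Proof.
case=> g [p [gK pK]]; apply/row_matrixP => i.
by rewrite row_mul !rowE -!pK gK.
Qed.

Lemma dual_basis_retract (M : lmodType A) :
  dual_basis M -> exists n (Q : 'M[A]_n), retract M Q.
Proof.
case=> n [x [c cE]].
have gL : linear (fun m => \row_i (c i m : A)).
  by move=> a u v; apply/rowP=> i; rewrite !mxE linearP.
exists n, (\matrix_(i, j) (c j (x i) : A)).
exists (mk_linear gL), (mk_linear (comb_linear x)); split=> [m|v] /=.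
  by rewrite [RHS]cE; apply: eq_bigr => i _; rewrite mxE.
apply/rowP=> j; rewrite !mxE linear_sum; apply: eq_bigr => i _.
by rewrite linearZ mxE.
Qed.

Lemma retract_dual_basis (M : lmodType A) n (Q : 'M[A]_n) :
  retract M Q -> dual_basis M.
Proof.
case=> g [p [gK pK]].
have cL i : linear (fun m : M => (g m 0 i : A^o)).
  by move=> a u v; rewrite linearP !mxE.
exists n, (fun i => p (delta_mx 0 i)), (fun i => mk_linear (cL i)) => m /=.
rewrite -[LHS]gK [g m in LHS]row_sum_delta linear_sum.
by apply: eq_bigr => i _; rewrite linearZ.
Qed.

(** Right multiplications by [U] and by [V] are mutually inverse between the images of U V and V
    U. *)
Lemma retract_factor (M : lmodType A) n r (U : 'M[A]_(n, r))
    (V : 'M[A]_(r, n)) :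
  V *m (U *m V) = V -> retract M (U *m V) -> retract M (V *m U).
Proof.
move=> VUV [g [p [gK pK]]].
have hL : linear (fun m => g m *m U).
  by move=> a u v; rewrite linearP mulmxDl -scalemxAl.
have qL : linear (fun v => p (v *m V)).
  by move=> a u v; rewrite mulmxDl -scalemxAl linearP.
exists (mk_linear hL), (mk_linear qL); split=> [m|v] /=.
  by rewrite -mulmxA -pK !gK.
by rewrite pK -[v *m V *m _]mulmxA VUV mulmxA.
Qed.

Section Image.
Variables (n : nat) (Q : 'M[A]_n).

(** For idempotent [Q] this is its image, described by an equation and hence by a boolean
    predicate. *)
Definition fixed_by : pred 'rV[A]_n := fun v => v *m Q == v.

Lemma fixed_by_submod_closed : submod_closed fixed_by.
Proof.
split=> [|a u v]; rewrite !unfold_in; first by rewrite mul0mx.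
by move=> /eqP uQ /eqP vQ; rewrite mulmxDl -scalemxAl uQ vQ.
Qed.

HB.instance Definition _ :=
  GRing.isSubmodClosed.Build A 'rV[A]_n fixed_by fixed_by_submod_closed.

Record fixed_vec := FixedVec {
  fixed_vec_val :> 'rV[A]_n; _ : fixed_vec_val \in fixed_by }.
HB.instance Definition _ := [isSub for fixed_vec_val].
HB.instance Definition _ := [Choice of fixed_vec by <:].
HB.instance Definition _ := [SubChoice_isSubLmodule of fixed_vec by <:].

Lemma fixed_vec_retract : Q *m Q = Q -> retract fixed_vec Q.
Proof.
move=> QQ; have vQ (v : 'rV_n) : v *m Q \in fixed_by.
  by rewrite unfold_in -mulmxA QQ.
have gL : linear (fixed_vec_val : fixed_vec -> 'rV_n) by [].
have pL : linear (fun v => FixedVec (vQ v)).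
  by move=> a u v; apply: val_inj; rewrite /= mulmxDl -scalemxAl.
exists (mk_linear gL), (mk_linear pL); split=> // v.
by apply: val_inj; apply/eqP; rewrite /=; case: v.
Qed.

End Image.
End Retracts.

(** * Base change of the image of an idempotent matrix *)

Section BaseChange.
Variables (A B : comPzRingType) (f : {rmorphism A -> B}).

Lemma base_change_retract (N : lmodType A) (M : lmodType B) n (Q : 'M[A]_n) :
  retract N Q -> retract M (map_mx f Q) -> iso (base_change f N) M.
Proof.
move=> [g [p [gK pK]]] [h [q [hK qK]]].
pose b (x : N) (c : B) : M := c *: q (map_mx f (g x)).
have bB : bbalanced f b.
  rewrite /b; split=> [x y c|x c d|a x c].
  - by rewrite linearD map_mxD linearD scalerDr.
  - exact: scalerDl.
  - by rewrite linearZ map_mxZ linearZ scalerA mulrC.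
(* The inverse pairs the generators p(e_i) of [N] with the coordinates of h(m). *)
pose k (m : M) : base_change f N := \sum_i btens f (p (delta_mx 0 i)) (h m 0 i).
apply: (mk_iso (g := btens_lift b) (h := k)).
- by apply: btens_lift_linear => // c x d; rewrite /b scalerA.
- have kD m m' : k (m + m') = k m + k m'.
    rewrite -big_split; apply: eq_bigr => i _.
    by rewrite linearD mxE btensDr.
  elim/base_change_ind=> [|x y IHx IHy|x c].
  + rewrite btens_lift0 //; apply: (addrI (k 0)).
    by rewrite -kD !addr0.
  + by rewrite btens_liftD // kD IHx IHy.
  + rewrite btens_liftE // /b /k linearZ qK -map_mxM -pK gK.
    rewrite -[in RHS](gK x) [g x in RHS]row_sum_delta linear_sum btens_suml.
    apply: eq_bigr => i _; rewrite linearZ btensZ !mxE; congr btens.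
    exact: mulrC.
- move=> m; rewrite /k.
  have btens_lift_sum (F : 'I_n -> base_change f N) :
      btens_lift b (\sum_i F i) = \sum_i btens_lift b (F i).
    by elim/big_rec2: _ => [|i y1 y2 _ <-]; rewrite ?btens_lift0 ?btens_liftD.
  rewrite btens_lift_sum.
  transitivity (q (h m *m map_mx f Q)); last by rewrite -qK !hK.
  rewrite [h m in RHS]row_sum_delta mulmx_suml linear_sum.
  apply: eq_bigr => i _; rewrite btens_liftE // /b -scalemxAl linearZ.
  by rewrite pK map_mxM map_delta_mx.
Qed.

End BaseChange.

(** * Lifting projective modules, and surjectivity on K_0 *)

Theorem theorem4p12 (A B : comPzRingType) (f : {rmorphism A -> B})
    (f_lifts : lifts_idempotents f)
    (B_semilocal : finite_set [set I : set B | is_maximal_ideal I]%classic) :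
  forall y : K0 B, exists x : K0 A, K0_map f x = y.
Proof.
have lift_proj (M : fgproj B) :
    exists N : fgproj A, iso (fgproj_base_change f N) M.
  have [n [P MP]] := dual_basis_retract (fgproj_dual_basis M).
  (* With r = n the rank hypothesis is automatic: a matrix of size n + 1 factoring through B^n has
     determinant 0. *)
  have [|d [U [V [dd UV VU _ VP]]]] :=
    idempotent_mx_diag B_semilocal (retract_idempotent MP) (r := n).
    by move=> X Y; rewrite -mulmxA; apply: det_mulmx_lt.
  (* Exchanging the factors makes [M] the image of the diagonal matrix V U, whose idempotent entries
     lift one at a time. *)
  rewrite -UV in VP MP; have := retract_factor VP MP; rewrite VU => Md.
  have /choice[e eP] : forall i, exists e : A, e * e = e /\ f e = d 0 i.
    by move=> i; have [e ee fe] := f_lifts _ (dd i); exists e.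
  pose Q := diag_mx (\row_i e i).
  have QQ : Q *m Q = Q.
    rewrite mulmx_diag; congr diag_mx; apply/rowP=> i.
    by rewrite !mxE; case: (eP i).
  have fQ : map_mx f Q = diag_mx d.
    rewrite map_diag_mx; congr diag_mx; apply/rowP=> i.
    by rewrite !mxE; case: (eP i).
  have NQ := fixed_vec_retract QQ.
  exists (fgproj_of_dual_basis (retract_dual_basis NQ)).
  by apply: base_change_retract NQ _; rewrite fQ.
move=> y; have [M [M' ->]] := K0_diff_surj y.
have [[N /isocls_ofP NM] [N' /isocls_ofP NM']] := (lift_proj M, lift_proj M').
by exists (K0_diff N N'); rewrite K0_mapE /K0_diff NM NM'.
Qed.
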